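(* For every non-negative integer $m$, \[ R_O(m)=\frac{2(2^{2m+2}-1)B_{2m+2}}{m+1}. \]
   Context: $B_s$ is the $s$th Bernoulli number (e.g. $B_2=1/6$, $B_4=-1/30$). The function $R_O$ on non-negative integers is defined by \[ R_O(m)=(2m+1)!\sum_{j=0}^{m}\left(-\frac12\right)^{j}\sum_{(i_0,i_1,\dots,i_j)\in O_{m,j}}\frac{1}{(2i_0-1)!(2i_1)!\cdots(2i_j)!} \] \[ =\sum_{j=0}^m\left(-\frac12\right)^j\sum_{(I_0,I_1,\dots,I_j)\in\tilde{O}_{m,j}}\binom{2I_1-1}{2I_0-1}\binom{2I_2-1}{2I_1-1}\cdots\binom{2I_j-1}{2I_{j-1}-1}, \] where these expressions agree, and $O_{m,j}=\{(i_0,i_1,\dots,i_j)\in\mathbb{Z}^{j+1} : i_0>0,i_1>0,\dots,i_j>0,\ i_0+i_1+\cdots+i_j=m+1\}$, $\tilde{O}_{m,j}=\{(I_0,I_1,\dots,I_j)\in\mathbb{Z}^{j+1} : 0<I_0<I_1<\cdots<I_j=m+1\}$; the product of binomial coefficients is interpreted as $1$ when $j=0$. *)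

(* Defs.v *)
From HB Require Import structures.
From mathcomp Require Import all_boot all_order all_algebra.
Set Implicit Arguments.
Unset Strict Implicit.
Unset Printing Implicit Defensive.
Import Order.TTheory GRing.Theory Num.Theory.
Local Open Scope ring_scope.

(* [:: B_0; ...; B_(n-1)], built from the standard recurrence
   \sum_(k <= n) 'C(n + 1, k) B_k = [n = 0], solved for B_n; see bernoulliE. *)
Fixpoint bernoulli_seq (n : nat) : seq rat :=
  if n is n'.+1 then
    let s := bernoulli_seq n' in
    rcons s (((n' == 0)%N%:R - \sum_(k < n') 'C(n'.+1, k)%:R * s`_k)
               / n'.+1%:R)
  else [::].

Definition bernoulli (n : nat) : rat := (bernoulli_seq n.+1)`_n.

Lemma size_bernoulli_seq n : size (bernoulli_seq n) = n.
Proof. by elim: n => //= n IHn; rewrite size_rcons IHn. Qed.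

Lemma nth_bernoulli_seq n k : (k < n)%N -> (bernoulli_seq n)`_k = bernoulli k.
Proof.
elim: n => // n IHn; rewrite ltnS leq_eqVlt => /orP[/eqP-> // | ltkn].
by rewrite /= nth_rcons size_bernoulli_seq ltkn IHn.
Qed.

Lemma bernoulliE n :
  \sum_(k < n.+1) 'C(n.+1, k)%:R * bernoulli k = (n == 0)%N%:R.
Proof.
rewrite big_ord_recr /= {2}/bernoulli /= nth_rcons size_bernoulli_seq ltnn eqxx.
rewrite binSn mulrC divfK ?pnatr_eq0 //.
under [X in _ - X]eq_bigr => k _ do rewrite nth_bernoulli_seq //.
by rewrite addrC subrK.
Qed.

(* O_(m,j).  Entries of a tuple of positive integers with sum m + 1 lie in
   {1, ..., m + 1}, so taking them in 'I_m.+2 = {0, ..., m + 1} loses none. *)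
Definition O_set (m j : nat) : {set {ffun 'I_j.+1 -> 'I_m.+2}} :=
  [set i : {ffun 'I_j.+1 -> 'I_m.+2} |
    [forall k, (0 < i k)%N] && (\sum_k (i k : nat) == m.+1)%N].

(* lift ord0 k, for k < j, runs over the indices 1, ..., j of 'I_j.+1.
   The truncated subtraction 2 * i_0 - 1 is exact since i_0 > 0 on O_set. *)
Definition R_O (m : nat) : rat :=
  ((2 * m + 1)`!)%:R *
  \sum_(j < m.+1) (- (1 / 2)) ^+ j *
    \sum_(i in O_set m j)
      1 / (((2 * i ord0 - 1)`! * \prod_(k < j) (2 * i (lift ord0 k))`!)%N)%:R.

(* Main.v *)
Require Import Defs.
From mathcomp Require Import all_boot all_order all_algebra.
From mathcomp Require Import ring zify.
Import Order.TTheory GRing.Theory Num.Theory.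
Local Open Scope ring_scope.

(* The x^(2m+2)-coefficient of x sinh x * \sum_j (- (cosh x - 1) / 2)^j
   = 2 x sinh x / (1 + cosh x) is R_O(m) / (2m+1)!.  On the other hand, with
   b(x) = x / (e^x - 1), one has
   b(2x) - b(x) + b(-2x) - b(-x) = x sinh x / (1 + cosh x),
   whose coefficients are read off from those of b.  Power series are
   represented by polynomials modulo a power of 'X. *)

Lemma dvdXnP (F : fieldType) (n : nat) (p : {poly F}) :
  reflect (forall i, (i < n)%N -> p`_i = 0) ('X^n %| p).
Proof.
rewrite /dvdp -Pdiv.IdomainMonic.take_poly_modp.
apply: (iffP eqP) => [t0 i ltin | p0].
  by have := coef_take_poly n p i; rewrite t0 coef0 ltin.
by apply/polyP => i; rewrite coef_take_poly coef0; case: ifP => // /p0.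
Qed.

Lemma coef_egfM (a b : nat -> rat) (n k : nat) : (k < n)%N ->
  ((\poly_(i < n) (a i / i`!%:R)) * (\poly_(i < n) (b i / i`!%:R)))`_k =
  (\sum_(i < k.+1) 'C(k, i)%:R * a i * b (k - i)%N) / k`!%:R.
Proof.
move=> ltkn; rewrite coefM mulr_suml; apply: eq_bigr => -[i /= leik] _.
rewrite !coef_poly (leq_trans leik ltkn) (leq_ltn_trans (leq_subr _ _) ltkn).
have fn0 j : j`!%:R != 0 :> rat by rewrite pnatr_eq0 -lt0n fact_gt0.
rewrite -(@bin_fact k i leik) !natrM.
have bn0 : 'C(k, i)%:R != 0 :> rat by rewrite pnatr_eq0 -lt0n bin_gt0.
by field; rewrite bn0 !fn0.
Qed.

Definition exp_poly (n : nat) (c : rat) : {poly rat} :=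
  \poly_(i < n) (c ^+ i / i`!%:R).

Definition bern_poly (n : nat) (c : rat) : {poly rat} :=
  \poly_(i < n) (c ^+ i * bernoulli i / i`!%:R).

Lemma exp_polyD n c d :
  'X^n %| exp_poly n c * exp_poly n d - exp_poly n (c + d).
Proof.
apply/dvdXnP => k ltkn; rewrite coefB coef_egfM // coef_poly ltkn -mulrBl.
rewrite (addrC c) exprDn -sumrB big1 ?mul0r // => -[i /= leik] _.
by rewrite -mulr_natl; ring.
Qed.

Lemma exp_poly0 n : exp_poly n.+1 0 = 1.
Proof.
apply/polyP => -[|k]; rewrite coef_poly coef1 //= ?divr1 //.
by rewrite expr0n mul0r if_same.
Qed.

(** This is b(cx) (e^(cx) - 1) = cx read coefficientwise: subtracting [bern_poly] removes the top
    term of the binomial convolution, and what remains is the recurrence [bernoulliE]. *)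
Lemma bern_polyE n c :
  'X^n %| bern_poly n c * (exp_poly n c - 1) - c *: 'X.
Proof.
apply/dvdXnP => k ltkn; rewrite mulrBr mulr1 !coefB coef_egfM //.
rewrite coef_poly ltkn coefZ coefX big_ord_recr /= subnn expr0 binn mul1r mulr1.
rewrite mulrDl addrK; case: k ltkn => [|k] ltkn.
  by rewrite big_ord0 mul0r mulr0 subr0.
under eq_bigr => i _.
  rewrite (_ : _ * _ = c ^+ k.+1 * ('C(k.+1, i)%:R * bernoulli i)); last first.
    have -> : c ^+ k.+1 = c ^+ i * c ^+ (k.+1 - i).
      by rewrite -exprD subnKC // ltnW.
    by ring.
  over.
rewrite -mulr_sumr bernoulliE; case: k ltkn => [|k] _ /=.
  by rewrite expr1 mulr1 divr1 subrr.
by rewrite !mulr0 mul0r subr0.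
Qed.

(** Ideal membership: each use follows a rewriting of the target as an explicit combination of known
    congruences, cofactors on the left, which [ring] checks. *)
Ltac dvd_ideal :=
  repeat first [assumption | apply: dvdp_add | rewrite dvdpNr | apply: dvdp_mull].

(** The truncated series of x tanh(x / 2). *)
Definition tanh_bern (n : nat) : {poly rat} :=
  bern_poly n 2 - bern_poly n 1 + bern_poly n (-2) - bern_poly n (-1).

(** Since e^(-x) is the inverse of e = e^x, every Bernoulli series is rational in x and e, which
    gives the identity multiplied by e - 1. Cancelling e - 1, which has a simple zero at x = 0,
    costs one power of ['X]; hence truncation at n + 1 for a congruence modulo ['X^n]. *)
Lemma tanh_bernE n : 'X^n %|
  tanh_bern n.+1 * (2 + exp_poly n.+1 1 + exp_poly n.+1 (-1))
  - 'X * (exp_poly n.+1 1 - exp_poly n.+1 (-1)).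
Proof.
have := exp_polyD n.+1 1 1; have := exp_polyD n.+1 (-1) (-1).
have := exp_polyD n.+1 1 (-1).
rewrite subrr exp_poly0 -opprD (_ : 1 + 1 = 2) //.
have := bern_polyE n.+1 1; have := bern_polyE n.+1 2.
have := bern_polyE n.+1 (-1); have := bern_polyE n.+1 (-2).
rewrite /tanh_bern scale1r !scaleNr scale1r !opprK !scaler_nat -!(mulr_natl 'X).
(* [v] is the truncation of (e^x - 1) / x. Its constant term is 1, except for n = 0, where the goal
   is divisibility by 1. *)
have : exists2 v : {poly rat}, exp_poly n.+1 1 - 1 = 'X * v & v`_0 != 0 \/ n = 0%N.
  exists (\poly_(i < n) (1 / i.+1`!%:R)).
    apply/polyP => -[|k]; rewrite coefB coefXM !coef_poly coef1 //= expr1n.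
    by rewrite subr0 ltnS.
  by case: (n) => [|k]; [right | left; rewrite coef_poly].
set e := exp_poly _ 1; set f := exp_poly _ (-1).
set e2 := exp_poly _ 2; set f2 := exp_poly _ (-2).
set b := bern_poly _ 1; set b' := bern_poly _ (-1).
set b2 := bern_poly _ 2; set b2' := bern_poly _ (-2).
move=> [v ev v0] Hb2' Hb' Hb2 Hb Hef Hff Hee.
case: v0 => [v0|->]; last by rewrite expr0 dvd1p.
set G := b2 - b + b2' - b'.
(* Cleared of denominators, [S1] to [S3] read b(2x) = 2x / (e^2 - 1), b(-2x) = 2x e^2 / (e^2 - 1)
   and b(-x) = x e / (e - 1). *)
have S1 : 'X^(n.+1) %| b2 * (e ^+ 2 - 1) - 2 * 'X.
  rewrite (_ : _ - _ = (b2 * (e2 - 1) - 2 * 'X) + b2 * (e * e - e2)); last by ring.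
  by dvd_ideal.
have S2 : 'X^(n.+1) %| b2' * (e ^+ 2 - 1) - 2 * 'X * e ^+ 2.
  rewrite (_ : _ - _ = (- e ^+ 2) * (b2' * (f2 - 1) + 2 * 'X)
    + (- (b2' * e ^+ 2)) * (f * f - f2) + (b2' * (e * f + 1)) * (e * f - 1)).
    by dvd_ideal.
  by ring.
have S3 : 'X^(n.+1) %| b' * (e - 1) - 'X * e.
  rewrite (_ : _ - _ = (- e) * (b' * (f - 1) + 'X) + b' * (e * f - 1)).
    by dvd_ideal.
  by ring.
have S4 : 'X^(n.+1) %| G * (e ^+ 2 - 1) - 'X * (e - 1) ^+ 2.
  rewrite (_ : _ - _ = (b2 * (e ^+ 2 - 1) - 2 * 'X)
    + (- (e + 1)) * (b * (e - 1) - 'X) + (b2' * (e ^+ 2 - 1) - 2 * 'X * e ^+ 2)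
    + (- (e + 1)) * (b' * (e - 1) - 'X * e)).
    by dvd_ideal.
  by rewrite /G; ring.
(* Modulo e f = 1 one has 2 + e + f = f (1 + e)^2 and e - f = f (e^2 - 1), so this is [S4]
   multiplied by f (1 + e). *)
have S5 : 'X^(n.+1) %| (e - 1) * (G * (2 + e + f) - 'X * (e - f)).
  rewrite (_ : _ * _ = (f * (1 + e)) * (G * (e ^+ 2 - 1) - 'X * (e - 1) ^+ 2)
    + ((e - 1) * ('X * e - G * (2 + e))) * (e * f - 1)).
    by dvd_ideal.
  by ring.
move: S5; rewrite ev exprS -mulrA dvdp_mul2l ?polyX_eq0 // Gauss_dvdpr //.
by rewrite coprimep_expl // coprimep_sym coprimepX rootE horner_coef0.
Qed.

Definition even_trunc (n : nat) (a : nat -> rat) : {poly rat} :=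
  (\poly_(i < n) a i) \Po 'X^2.

Lemma coef_even_trunc n a k : (k < 2 * n)%N ->
  (even_trunc n a)`_k = if odd k then 0 else a k./2.
Proof.
move=> ltk; rewrite coef_comp_poly_Xn // dvdn2 divn2 coef_poly.
by case: (odd k) => //=; rewrite ifT //; lia.
Qed.

Lemma even_truncE n a : even_trunc n a = \sum_(i < n) a i *: 'X^(2 * i).
Proof.
rewrite /even_trunc poly_def rmorph_sum /=; apply: eq_bigr => i _.
by rewrite linearZ /= comp_Xn_poly exprM.
Qed.

(* x sinh x and cosh x - 1 as series in x^2. *)
Definition xsinh_coef (i : nat) : rat :=
  if i == 0%N then 0 else 1 / ((2 * i - 1)`!)%:R.
Definition cosh1_coef (i : nat) : rat :=
  if i == 0%N then 0 else 1 / ((2 * i)`!)%:R.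

(** Distributing the product gives a sum over all functions f, of which the coefficient of degree 2m
    + 2 keeps those with sum m + 1. The zero constant terms of both series discard every f with a
    zero entry. *)
Lemma sum_O_setE m j :
  \sum_(i in O_set m j)
    1 / (((2 * i ord0 - 1)`! * \prod_(k < j) (2 * i (lift ord0 k))`!)%N)%:R
  = (even_trunc m.+2 xsinh_coef * even_trunc m.+2 cosh1_coef ^+ j)`_(2 * m + 2).
Proof.
pose a (k : 'I_j.+1) := if k == ord0 then xsinh_coef else cosh1_coef.
have -> : even_trunc m.+2 xsinh_coef * even_trunc m.+2 cosh1_coef ^+ j
    = \prod_(k < j.+1) \sum_(i < m.+2) a k i *: 'X^(2 * i).
  rewrite big_ord_recl /= -even_truncE; congr (_ * _).
  under eq_bigr do rewrite -even_truncE (_ : a _ = cosh1_coef) //.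
  by rewrite prodr_const card_ord.
rewrite bigA_distr_bigA coef_sum big_mkcond /=; apply: eq_bigr => f _.
rewrite scaler_prod coefZ.
have -> : \prod_(i < j.+1) 'X^(2 * f i) = 'X^(2 * \sum_(i < j.+1) f i) :> {poly rat}.
  by rewrite big_distrr /= expr_sum.
rewrite coefXn inE.
have -> : (2 * m + 2 == 2 * \sum_(i < j.+1) f i)%N = (\sum_(i < j.+1) f i == m.+1)%N.
  by lia.
case: eqP => _; rewrite ?andbF ?mulr0 // andbT mulr1.
case: forallP => [f_gt0 | /forallP/forallPn[k]].
  rewrite big_ord_recl /= /a eqxx /xsinh_coef -[(_ == 0)%N]negbK -lt0n f_gt0 /=.
  rewrite natrM invfM !mul1r natr_prod -prodfV; congr (_ * _); apply: eq_bigr => k _.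
  by rewrite /cosh1_coef -[(_ == 0)%N]negbK -lt0n f_gt0 /= mul1r.
rewrite -eqn0Ngt => /eqP fk0.
rewrite (bigD1 k) //= /a fk0 /xsinh_coef /cosh1_coef.
by case: ifP; rewrite mul0r.
Qed.

Lemma R_OE m : R_O m = ((2 * m + 1)`!)%:R *
  (even_trunc m.+2 xsinh_coef *
   \sum_(j < m.+1) (- (1 / 2 *: even_trunc m.+2 cosh1_coef)) ^+ j)`_(2 * m + 2).
Proof.
rewrite /R_O [in RHS]mulr_sumr coef_sum; congr (_ * _); apply: eq_bigr => j _.
by rewrite sum_O_setE -scaleNr exprZn -scalerAr coefZ.
Qed.

(** The exponent 2m + 3 just reaches the coefficient of x^(2m+2); the exponentials are truncated at
    2m + 4 because [tanh_bernE] loses one power. *)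
Lemma xsinhE m : 'X^(2 * m + 3) %| 2 * even_trunc m.+2 xsinh_coef
  - 'X * (exp_poly (2 * m + 4) 1 - exp_poly (2 * m + 4) (-1)).
Proof.
apply/dvdXnP => k ltk; rewrite coefB coefXM mulr_natl coefMn.
rewrite coef_even_trunc; last by lia.
rewrite coefB !coef_poly expr1n -signr_odd /xsinh_coef.
case: k ltk => [|k] /=; rewrite ?mul0rn ?subrr // => ltk.
have -> : (k < 2 * m + 4)%N by lia.
case: (boolP (odd k)) => /= ok; last by rewrite expr0 mul0rn !subrr.
rewrite ifF; last by apply/eqP; lia.
rewrite (_ : 2 * uphalf k - 1 = k)%N; last by lia.
by rewrite expr1 mulr2n; ring.
Qed.

(** With H = (cosh x - 1) / 2, this is 4 (1 + H) = 2 + 2 cosh x. *)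
Lemma coshE m : 'X^(2 * m + 3) %|
  4 * (1 + 1 / 2 *: even_trunc m.+2 cosh1_coef)
  - (2 + exp_poly (2 * m + 4) 1 + exp_poly (2 * m + 4) (-1)).
Proof.
apply/dvdXnP => k ltk; rewrite coefB mulr_natl coefMn !coefD coefZ.
rewrite coef_even_trunc; last by lia.
rewrite !coef_poly; have -> : (k < 2 * m + 4)%N by lia.
rewrite coef1 expr1n -signr_odd /cosh1_coef.
case: k ltk => [|k] /= ltk; first by [].
set y := (k.+1)`!%:R^-1.
case: (boolP (odd k)) => /= ok; last by rewrite expr1; ring.
rewrite ifF; last by apply/eqP; lia.
rewrite (_ : 2 * uphalf k = k.+1)%N; last by lia.
by rewrite expr0 -/y; field.
Qed.

Lemma dvdp_even_trunc n a : (0 < n)%N -> a 0%N = 0 -> 'X^2 %| even_trunc n a.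
Proof.
by move=> n0 a0; apply/dvdXnP => -[|[|k]] // _; rewrite coef_even_trunc ?a0 //; lia.
Qed.

Theorem lemma2p2 (m : nat) :
  R_O m = 2 * (2 ^+ (2 * m + 2) - 1) * bernoulli (2 * m + 2) / (m%:R + 1).
Proof.
rewrite R_OE; set S := even_trunc _ xsinh_coef; set H := _ *: even_trunc _ _.
set T := S * _; set G := tanh_bern (2 * m + 4).
(* The geometric sum leaves the remainder -S (-H)^(m+1). Both S and H are divisible by ['X^2], so it
   vanishes to order 2m + 4, and stopping at j = m is harmless. *)
have HT : 'X^(2 * m + 3) %| (1 + H) * T - S.
  have -> : (1 + H) * T - S = - (S * (- H) ^+ m.+1).
    have := subrX1 (- H) m.+1; rewrite /T; set s := \sum_(j < _) _ => Hs.
    have -> : (- H) ^+ m.+1 = (- H - 1) * s + 1 by rewrite -Hs subrK.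
    by ring.
  rewrite dvdpNr (dvdp_trans (dvdp_exp2l 'X (_ : _ <= 2 + 2 * m.+1)%N)) //; first lia.
  rewrite exprD exprM dvdp_mul ?dvdp_even_trunc //.
  by rewrite dvdp_exp2r // dvdpNr dvdpZr ?dvdp_even_trunc.
(* As 1 + H = (1 + cosh x) / 2, the series 2 G solves the same linear equation as T. *)
have HG : 'X^(2 * m + 3) %| (1 + H) * (2 * G) - S.
  rewrite -(@dvdpZr _ 2) // scaler_nat.
  have := tanh_bernE (2 * m + 3); rewrite -addnS -/G => HG.
  have Hs := xsinhE m; have Hc := coshE m; rewrite -/S -/H in Hs Hc.
  move: HG Hs Hc; set e := exp_poly _ 1; set f := exp_poly _ (-1) => HG Hs Hc.
  rewrite (_ : ((1 + H) * (2 * G) - S) *+ 2 =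
    G * (4 * (1 + H) - (2 + e + f)) - (2 * S - 'X * (e - f))
    + (G * (2 + e + f) - 'X * (e - f))).
    by dvd_ideal.
  by ring.
have : 'X^(2 * m + 3) %| (1 + H) * (T - 2 * G).
  rewrite (_ : _ * _ = ((1 + H) * T - S) - ((1 + H) * (2 * G) - S)).
    by dvd_ideal.
  by ring.
rewrite Gauss_dvdpr; last first.
  rewrite coprimep_expl // coprimep_sym coprimepX rootE horner_coef0 coefD coefZ.
  by rewrite coef1 coef_even_trunc //= /cosh1_coef mulr0 addr0.
move=> /dvdXnP/(_ (2 * m + 2)%N); rewrite coefB => /(_ _)/eqP; rewrite subr_eq0.
move=> /(_ _)/eqP-> //; last by lia.
have lt2m : (2 * m + 2 < 2 * m + 4)%N by lia.
(* In the even degree 2m + 2 the terms for c and -c agree, so G has coefficient 2 (2^(2m+2) - 1)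
   B_(2m+2) / (2m+2)!, to be multiplied by 2 (2m+1)!. *)
rewrite (mulr_natl G) coefMn /G /tanh_bern !(coefB, coefD) !coef_poly lt2m.
rewrite (exprNn 2) -(signr_odd _ (2 * m + 2)) expr1n.
have -> : odd (2 * m + 2) = false by lia.
have -> : (2 * m + 2)`!%:R = 2 * (m%:R + 1) * (2 * m + 1)`!%:R :> rat.
  by rewrite addn2 addn1 factS natr1 -!natrM; congr _%:R; lia.
have f0 : (2 * m + 1)`!%:R != 0 :> rat by rewrite pnatr_eq0 -lt0n fact_gt0.
have m0 : m%:R + 1 != 0 :> rat by rewrite natr1 pnatr_eq0.
by field; rewrite m0 f0.
Qed.
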